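(* Let $d\ge 2$, name the variables $z_1,\dots,z_{d-2},x,y$, and let $f\in\mathbb{C}\langle\langle z_1,\dots,z_{d-2},x,y\rangle\rangle_{\ge 2}$. Then the following hold. (1) $\mathrm{corank}(f)\le 1$ if and only if either $f\cong z_1^2+\cdots+z_{d-2}^2+x^2$, or $f\cong z_1^2+\cdots+z_{d-2}^2+x^2+y^n$ for some integer $n\ge 2$. Each potential $z_1^2+\cdots+z_{d-2}^2+x^2+y^n$ ($n\geq 2$) has finite dimensional Jacobi algebra, whereas the Jacobi algebra of $z_1^2+\cdots+z_{d-2}^2+x^2$ is infinite dimensional, with $\mathfrak{J}$-dimension equal to $1$. (2) If $d=2$, i.e. $f\in\mathbb{C}\langle\langle x,y\rangle\rangle_{\ge2}$, then $\mathrm{Jac}(f)$ is commutative if and only if $\mathrm{corank}(f)\le 1$.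
   Context: $\mathbb{C}\langle\langle x_1,\dots,x_d\rangle\rangle$ is the ring of formal power series in $d$ noncommuting variables over $\mathbb{C}$, with two-sided maximal ideal $\mathfrak{n}$ of series with zero constant term and the $\mathfrak{n}$-adic topology; the closure of a subset $S$ is $\bigcap_{i\ge0}(S+\mathfrak{n}^i)$. The subscript $\ge t$ denotes series all of whose homogeneous components of degree $<t$ vanish. The cyclic derivative $\delta_i$ is the $\mathbb{C}$-linear (termwise) map given on monomials by $\delta_i(x_{i_1}\cdots x_{i_t})=\sum_{j:\,i_j=i}x_{i_{j+1}}\cdots x_{i_t}x_{i_1}\cdots x_{i_{j-1}}$. The Jacobi algebra is $\mathrm{Jac}(f)=\mathbb{C}\langle\langle x_1,\dots,x_d\rangle\rangle/I$ where $I$ is the closure of the two-sided ideal $(\delta_1f,\dots,\delta_df)$. We write $f\cong g$ when $\mathrm{Jac}(f)\cong\mathrm{Jac}(g)$ as algebras. For $f$ of order $\ge2$, let $\mathfrak{J}$ be the Jacobson radical of $\mathrm{Jac}(f)$. The corank is $\mathrm{corank}(f)=\dim_{\mathbb{C}}\mathfrak{J}/\mathfrak{J}^2$. The $\mathfrak{J}$-dimension of $\mathrm{Jac}(f)$ is the infimum of those real $r\ge0$ for which there is $c\in\mathbb{R}$ with $\dim_{\mathbb{C}}\mathrm{Jac}(f)/\mathfrak{J}^n\le cn^r$ for all $n\in\mathbb{N}$ (and is $\infty$ if no such $r$ exists). *)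

(* Defs.v *)
From HB Require Import structures.
From mathcomp Require Import all_boot all_order all_algebra.
From mathcomp Require Import generic_quotient ring_quotient complex.
From mathcomp Require Import all_classical all_reals all_analysis.

Set Implicit Arguments.
Unset Strict Implicit.
Unset Printing Implicit Defensive.

Import Order.TTheory GRing.Theory Num.Theory.

Local Open Scope classical_set_scope.
Local Open Scope ring_scope.

Section Ideals.
Variable A : pzRingType.
Implicit Types I J : set A.

Definition additive_subgroup I := I 0 /\ forall x y, I x -> I y -> I (x - y).

Definition left_ideal I :=
  additive_subgroup I /\ forall a x, I x -> I (a * x).

Definition two_sided_ideal I :=
  left_ideal I /\ forall a x, I x -> I (x * a).

Definition maximal_left_ideal I :=
  [/\ left_ideal I, I <> setT &
      forall J, left_ideal J -> I `<=` J -> J = I \/ J = setT].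

Definition jacobson_radical : set A :=
  \bigcap_(I in maximal_left_ideal) I.

Definition ideal_generated (S : set A) : set A := smallest two_sided_ideal S.

Definition ideal_mul I J : set A :=
  smallest additive_subgroup [set x * y | x in I & y in J].

Fixpoint ideal_pow I n : set A :=
  if n is n'.+1 then ideal_mul (ideal_pow I n') I else setT.

End Ideals.

Arguments jacobson_radical A : clear implicits.

Record tsideal (A : pzRingType) := TSIdeal {
  tsideal_set : set A;
  tsidealP : two_sided_ideal tsideal_set }.

Section QuotientAlgebra.
Variables (K : fieldType) (A : algType K) (I : tsideal A).

Definition tsideal_pred : pred A := fun x => `[< tsideal_set I x >].

Lemma tsideal_zmod_closed : zmod_closed tsideal_pred.
Proof.
have [[[I0 IB] _] _] := tsidealP I.
split=> [|x y]; first exact/asboolP.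
by rewrite !unfold_in => /asboolP Ix /asboolP Iy; apply/asboolP/IB.
Qed.

HB.instance Definition _ :=
  GRing.isZmodClosed.Build A tsideal_pred tsideal_zmod_closed.

Definition tsideal_zmod : zmodClosed A :=
  GRing.ZmodClosed.clone A tsideal_pred _.

Definition quot_alg : Type := Quotient.quot tsideal_zmod.

HB.instance Definition _ := GRing.Zmodule.on quot_alg.
HB.instance Definition _ :
  EqQuotient A (Quotient.equiv tsideal_zmod) quot_alg := EqQuotient.on quot_alg.

Local Notation qpi := (\pi_quot_alg)%qT.

Lemma quot_algE (x y : A) : (qpi x = qpi y) <-> tsideal_set I (x - y).
Proof.
by split=> [/eqmodP/asboolP //|Ixy]; apply/eqmodP/asboolP.
Qed.

Lemma qpi_add (x y : A) : qpi (x + y) = qpi x + qpi y.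
Proof. exact: (Quotient.pi_add tsideal_zmod). Qed.

Definition quot_mul (u v : quot_alg) : quot_alg := qpi (repr u * repr v)%qT.
Definition quot_scale (c : K) (u : quot_alg) : quot_alg := qpi (c *: repr u)%qT.

Lemma quot_mulE (x y : A) : quot_mul (qpi x) (qpi y) = qpi (x * y).
Proof.
have [[[I0 IB] IMl] IMr] := tsidealP I.
have ID u v : tsideal_set I u -> tsideal_set I v -> tsideal_set I (u + v).
  move=> Iu Iv; rewrite -[v]opprK; apply: (IB) => //.
  by rewrite -[- v]sub0r; apply: (IB).
apply/quot_algE; set x' := repr _; set y' := repr _.
have Ix : tsideal_set I (x' - x) by apply/quot_algE; rewrite reprK.
have Iy : tsideal_set I (y' - y) by apply/quot_algE; rewrite reprK.
rewrite -[x' * y'](addrNK (x' * y)) -mulrBr -addrA -mulrBl.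
by apply: (ID); [apply: IMl|apply: IMr].
Qed.

Lemma quot_scaleE c (x : A) : quot_scale c (qpi x) = qpi (c *: x).
Proof.
have [[_ IMl] _] := tsidealP I.
apply/quot_algE; rewrite -scalerBr -mulr_algl; apply: IMl.
by apply/quot_algE; rewrite reprK.
Qed.

Lemma quotP (P : quot_alg -> Prop) : (forall x, P (qpi x)) -> forall u, P u.
Proof. by move=> Px u; rewrite -[u]reprK. Qed.

Lemma quot_mulA : associative quot_mul.
Proof.
elim/quotP=> x; elim/quotP=> y; elim/quotP=> z.
by rewrite !quot_mulE mulrA.
Qed.

Lemma quot_mul1 : left_id (qpi 1) quot_mul.
Proof. by elim/quotP=> x; rewrite quot_mulE mul1r. Qed.

Lemma quot_mulr1 : right_id (qpi 1) quot_mul.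
Proof. by elim/quotP=> x; rewrite quot_mulE mulr1. Qed.

Lemma quot_mulDl : left_distributive quot_mul +%R.
Proof.
elim/quotP=> x; elim/quotP=> y; elim/quotP=> z.
by rewrite -qpi_add !quot_mulE -qpi_add mulrDl.
Qed.

Lemma quot_mulDr : right_distributive quot_mul +%R.
Proof.
elim/quotP=> x; elim/quotP=> y; elim/quotP=> z.
by rewrite -qpi_add !quot_mulE -qpi_add mulrDr.
Qed.

(* The quotient may be the zero ring, hence [pzRingType] and no [algType]. *)
HB.instance Definition _ := GRing.Zmodule_isPzRing.Build quot_alg
  quot_mulA quot_mul1 quot_mulr1 quot_mulDl quot_mulDr.

Lemma quot_scaleA a b u : quot_scale a (quot_scale b u) = quot_scale (a * b) u.
Proof. by elim/quotP: u => x; rewrite !quot_scaleE scalerA. Qed.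

Lemma quot_scale1 : left_id 1 quot_scale.
Proof. by elim/quotP=> x; rewrite quot_scaleE scale1r. Qed.

Lemma quot_scaleDr : right_distributive quot_scale +%R.
Proof.
move=> a; elim/quotP=> x; elim/quotP=> y.
by rewrite -qpi_add !quot_scaleE -qpi_add scalerDr.
Qed.

Lemma quot_scaleDl u : {morph quot_scale^~ u : a b / a + b}.
Proof.
move=> a b; elim/quotP: u => x.
by rewrite !quot_scaleE -qpi_add scalerDl.
Qed.

HB.instance Definition _ := GRing.Zmodule_isLmodule.Build K quot_alg
  quot_scaleA quot_scale1 quot_scaleDr quot_scaleDl.

End QuotientAlgebra.

Section Dimension.
Variables (R : realType) (K : fieldType) (M : lmodType K).

Definition free_mod (V : set M) n (v : 'I_n -> M) :=
  forall c : 'I_n -> K, V (\sum_(i < n) c i *: v i) -> forall i, c i = 0.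

(* dim U/V for subspaces V <= U, as an extended real (+oo when infinite) *)
Definition dim_mod (U V : set M) : \bar R :=
  ereal_sup [set n%:R%:E | n in
    [set n | exists v : 'I_n -> M, (forall i, U (v i)) /\ free_mod V v]].

End Dimension.

(* A series is the family of its coefficients, indexed by words in 'I_d. *)
Definition ncseries (K : fieldType) (d : nat) : Type := seq 'I_d -> K.

Section Series.
Variables (K : fieldType) (d : nat).
Local Notation S := (ncseries K d).
Implicit Types f g h : S.

HB.instance Definition _ := GRing.Lmodule.copy S (seq 'I_d -> K^o).

Definition ncone : S := fun w => (w == [::])%:R.

Definition ncmul f g : S := fun w =>
  \sum_(i < (size w).+1) f (take i w) * g (drop i w).

Lemma ncmul_nil f g : ncmul f g [::] = f [::] * g [::].
Proof. by rewrite /ncmul big_ord1. Qed.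

Lemma ncmul_cons f g a w :
  ncmul f g (a :: w) = f [::] * g (a :: w) + ncmul (fun u => f (a :: u)) g w.
Proof. by rewrite /ncmul big_ord_recl. Qed.

Lemma ncmulDl : left_distributive ncmul +%R.
Proof.
move=> f g h; apply/funext => w; rewrite /ncmul [RHS]/GRing.add/= -big_split.
by apply: eq_bigr => i _; rewrite /= -mulrDl.
Qed.

Lemma ncmulDr : right_distributive ncmul +%R.
Proof.
move=> f g h; apply/funext => w; rewrite /ncmul [RHS]/GRing.add/= -big_split.
by apply: eq_bigr => i _; rewrite /= -mulrDr.
Qed.

Lemma ncmulZl c f g : c *: ncmul f g = ncmul (c *: f) g.
Proof.
apply/funext => w; rewrite /ncmul [LHS]/GRing.scale/=.
rewrite [LHS]/GRing.scale/= mulr_sumr.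
by apply: eq_bigr => i _; rewrite mulrA.
Qed.

Lemma ncmulZr c f g : c *: ncmul f g = ncmul f (c *: g).
Proof.
apply/funext => w; rewrite /ncmul [LHS]/GRing.scale/=.
rewrite [LHS]/GRing.scale/= mulr_sumr.
by apply: eq_bigr => i _; rewrite mulrCA.
Qed.

Lemma ncmulA : associative ncmul.
Proof.
move=> f g h; apply/funext => w.
elim: w f => [|a w IHw] f; first by rewrite !ncmul_nil mulrA.
rewrite !ncmul_cons IHw ncmul_nil mulrDr mulrA -addrA; congr (_ + _).
have -> : (fun u => ncmul f g (a :: u)) =
    f [::] *: ((fun u => g (a :: u)) : S) +
    ncmul (fun u => f (a :: u)) g :> S.
  by apply/funext => u; rewrite ncmul_cons.
by rewrite ncmulDl -ncmulZl.
Qed.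

Lemma ncmul1 : left_id ncone ncmul.
Proof.
move=> f; apply/funext => w; rewrite /ncmul big_ord_recl take0 drop0 mul1r.
rewrite big1 ?addr0// => i _; rewrite /ncone.
by case: w i => [[]//|a w] i; rewrite mul0r.
Qed.

Lemma ncmulr1 : right_id ncone ncmul.
Proof.
move=> f; apply/funext => w; rewrite /ncmul big_ord_recr/=.
rewrite take_size drop_size mulr1 big1 ?add0r// => i _.
by rewrite /ncone -size_eq0 size_drop subn_eq0 leqNgt ltn_ord mulr0.
Qed.

Lemma ncone_neq0 : ncone != 0.
Proof. by apply/eqP => /(congr1 (@^~ [::])) /eqP; rewrite oner_eq0. Qed.

HB.instance Definition _ := GRing.Zmodule_isNzRing.Build S
  ncmulA ncmul1 ncmulr1 ncmulDl ncmulDr ncone_neq0.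

HB.instance Definition _ := GRing.Lmodule_isLalgebra.Build K S ncmulZl.
HB.instance Definition _ := GRing.Lalgebra_isAlgebra.Build K S ncmulZr.

Definition ncvar (i : 'I_d) : S := fun w => (w == [:: i])%:R.

Definition order_ge (t : nat) f := forall w, (size w < t)%N -> f w = 0.

Definition ncmax : set S := [set f | f [::] = 0].

Definition ncclosure (T : set S) : set S :=
  \bigcap_i [set s + h | s in T & h in ideal_pow ncmax i].

(* The coefficient of [w] in the termwise cyclic derivative: each word [m] of
   length [size w + 1] contributes [f m] once for every position [j] of the
   letter [i] in [m] such that the monomial obtained by cyclically rotating [m]
   and removing that letter is [w]. *)
Definition cyclic_derivative (i : 'I_d) f : S := fun w =>
  \sum_(m : (size w).+1.-tuple 'I_d)
    \sum_(j < (size w).+1 | (tnth m j == i) &&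
                            (drop j.+1 m ++ take j m == w)) f m.

Definition jacobian_set f : set S :=
  ncclosure (ideal_generated (range (cyclic_derivative^~ f))).

Lemma ideal_generated_ideal (A : pzRingType) (T : set A) :
  two_sided_ideal (ideal_generated T).
Proof.
split; first split; first split.
- by move=> J [[[[J0 _] _] _] _].
- move=> x y Tx Ty J TJ; have [[[[_ JB] _] _] _] := TJ.
  by apply: JB; [apply: Tx|apply: Ty].
- move=> a x Tx J TJ; have [[[_ JM] _] _] := TJ.
  by apply: JM; apply: Tx.
- move=> a x Tx J TJ; have [[_ JM] _] := TJ.
  by apply: JM; apply: Tx.
Qed.

Lemma ideal_pow_ideal (A : pzRingType) (I : set A) n :
  two_sided_ideal I -> two_sided_ideal (ideal_pow I n).
Proof.
move=> [[_ IMl] IMr]; elim: n => [|n [[[_ _] IHl] _]] //.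
have sub0 : additive_subgroup (ideal_mul (ideal_pow I n) I).
  split=> [J [[J0 _] _] //|x y Ix Iy J JI].
  by have [[_ JB] _] := JI; apply: JB; [apply: Ix|apply: Iy].
have [I0 IB] := sub0.
split=> [|a x]; first split=> // a x.
- move: x; apply: (smallest_sub (X := [set x | ideal_mul (ideal_pow I n) I (a * x)])).
    split=> [|u v /= Iu Iv]; first by rewrite /= mulr0.
    by rewrite mulrBr; apply: IB.
  move=> _ [u Iu [v Iv <-]] /=; rewrite mulrA.
  by apply: sub_gen_smallest; exists (a * u); [apply: IHl|exists v].
- move: x; apply: (smallest_sub
    (X := [set x | ideal_mul (ideal_pow I n) I (x * a)])).
    split=> [|u v /= Iu Iv]; first by rewrite /= mul0r.
    by rewrite mulrBl; apply: IB.
  move=> _ [u Iu [v Iv <-]] /=; rewrite -mulrA.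
  by apply: sub_gen_smallest; exists u => //; exists (v * a) => //; apply: IMr.
Qed.

Lemma ncmax_ideal : two_sided_ideal ncmax.
Proof.
split; first split; first split=> [//|f g f0 g0].
- by rewrite /ncmax/= /GRing.add/= /GRing.opp/= f0 g0 subr0.
- by move=> a f f0; rewrite /ncmax/= [LHS]ncmul_nil f0 mulr0.
- by move=> a f f0; rewrite /ncmax/= [LHS]ncmul_nil f0 mul0r.
Qed.

Lemma ncclosure_ideal (T : set S) :
  two_sided_ideal T -> two_sided_ideal (ncclosure T).
Proof.
move=> [[[T0 TB] Tl] Tr].
split; first split; first split.
- move=> i _; have [[[N0 _] _] _] := ideal_pow_ideal i ncmax_ideal.
  by exists 0 => //; exists 0 => //; rewrite addr0.
- move=> f g clf clg i _; have [[[_ NB] _] _] := ideal_pow_ideal i ncmax_ideal.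
  have [s Ts [h Nh <-]] := clf i Logic.I.
  have [s' Ts' [h' Nh' <-]] := clg i Logic.I.
  exists (s - s'); first exact: TB.
  by exists (h - h'); [exact: NB|rewrite opprD addrACA].
- move=> a f clf i _; have [[_ Nl] _] := ideal_pow_ideal i ncmax_ideal.
  have [s Ts [h Nh <-]] := clf i Logic.I.
  exists (a * s); first exact: Tl.
  by exists (a * h); [exact: Nl|rewrite mulrDr].
- move=> a f clf i _; have [_ Nr] := ideal_pow_ideal i ncmax_ideal.
  have [s Ts [h Nh <-]] := clf i Logic.I.
  exists (s * a); first exact: Tr.
  by exists (h * a); [exact: Nr|rewrite mulrDl].
Qed.

Definition jacobian_ideal f : tsideal S :=
  @TSIdeal S (jacobian_set f) (ncclosure_ideal (ideal_generated_ideal _)).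

Definition Jac f : Type := quot_alg (jacobian_ideal f).

HB.instance Definition _ f := GRing.PzRing.on (Jac f).
HB.instance Definition _ f := GRing.Lmodule.on (Jac f).

(* A ring isomorphism that is also K-linear. *)
Definition jac_iso f g :=
  exists phi : {rmorphism Jac f -> Jac g}, scalable phi /\ bijective phi.

End Series.

Section Invariants.
Variables (R : realType) (d : nat).
Implicit Types f : ncseries R[i] d.

Definition jac_dim f : \bar R := dim_mod R (setT : set (Jac f)) [set 0].

Definition corank f : \bar R :=
  let J := jacobson_radical (Jac f) in dim_mod R J (ideal_pow J 2).

(* [ereal_inf set0] is [+oo] *)
Definition jdim f : \bar R :=
  let J := jacobson_radical (Jac f) in
  ereal_inf [set r%:E | r in [set r : R | 0 <= r /\
    exists c : R, forall n : nat,
      (dim_mod R setT (ideal_pow J n) <= (c * n%:R `^ r)%:E)%E]].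

End Invariants.

(* For d >= 2 the variables z_1, ..., z_(d-2), x, y are indexed in this order
   by 0, ..., d-3, d-2, d-1. *)

Lemma ltn_subr2 d : (2 <= d)%N -> (d - 2 < d)%N.
Proof. by case: d => [|[|d]]// _; rewrite subn2/=. Qed.

Lemma ltn_subr1 d : (2 <= d)%N -> (d - 1 < d)%N.
Proof. by case: d => [|d]// _; rewrite subn1. Qed.

Section NormalForms.
Variables (K : fieldType) (d : nat) (hd : (2 <= d)%N).

Definition varz (k : 'I_(d - 2)) : ncseries K d :=
  ncvar K (widen_ord (leq_subr 2 d) k).
Definition varx : ncseries K d := ncvar K (Ordinal (ltn_subr2 hd)).
Definition vary : ncseries K d := ncvar K (Ordinal (ltn_subr1 hd)).

Definition normal_form_inf : ncseries K d :=
  \sum_(k < d - 2) varz k ^+ 2 + varx ^+ 2.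
Definition normal_form (n : nat) : ncseries K d :=
  \sum_(k < d - 2) varz k ^+ 2 + varx ^+ 2 + vary ^+ n.

End NormalForms.

(* Main.v *)
From HB Require Import structures.
Require Import Defs.
From mathcomp Require Import all_boot all_order all_algebra complex.
From mathcomp Require Import all_classical all_reals all_analysis.
From mathcomp Require Import ring zify.

Set Implicit Arguments.
Unset Strict Implicit.
Unset Printing Implicit Defensive.

Import Order.TTheory GRing.Theory Num.Theory.

Local Open Scope classical_set_scope.
Local Open Scope ring_scope.

(** The key observation is that corank at most one makes Jac(f) a quotient of
    the power series ring in one variable, and such quotients are classified
    by their length.  Changes of variables in the noncommutative ring, and the
    splitting of a potential into a quadratic part and a remainder, can thus
    be avoided.

    Write n for the series without constant term and I for the closed Jacobian
    ideal.  When f has order at least 2, I is contained in n, and since series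
    outside n are invertible, Jac(f) is local with radical n / I
    ([jac_radicalE]).  Its powers are the images of the n^k, and n^k consists
    of the series of order at least k ([ideal_pow_ncmax],
    [jac_radical_pow]).  Hence corank(f) <= 1 says exactly that some t in n
    satisfies n = C t + n^2 + I ([dim_cotangent_le1]).  Call such t a
    generator.

    Multiplying out, n^k is contained in C t^k + n^(k+1) + I.  Successive
    approximation, together with the closedness of I, writes every series as a
    power series in t modulo I ([generator_expand]).  So Jac(f) is commutative,
    and it is the quotient of C[[T]] by the kernel of T |-> t.  If k is the
    least exponent with t^k in I + n^(k+1), then n^k is contained in I
    ([power_annihilates]), and the kernel is (T^k); if there is no such
    exponent, the kernel is zero ([pseval_jacobian]).

    For the normal forms, all the variables but y lie in I, so y is a
    generator, and I is the set of series whose coefficients at y^i vanish for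
    i < n - 1, respectively for all i ([normal_form_jacobian],
    [normal_form_inf_jacobian]).  Comparing kernels, f is isomorphic to the
    normal form with n = k + 1, or to the one without a power of y
    ([generator_normal_form]).  Conversely a generator can be transported along
    an isomorphism ([jac_iso_generator]).  Since the powers of y are
    independent in the infinite case, the quotient by the N-th power of the
    radical has dimension N ([generator_dim], [axis_free]), which gives the
    growth exponent 1.

    For the converse in two variables, suppose that no cyclic derivative of f
    has a linear term.  The quadratic part of a cyclic derivative in two
    variables is symmetric in xy and yx, so the series without terms of degree
    at most 1 and with equal coefficients at xy and yx form a closed ideal
    containing I ([jacobian_commutator_free]); it does not contain xy - yx.  So
    if Jac(f) is commutative, then some cyclic derivative has a linear term,
    which makes one of the variables a generator ([commutative_generator]). *)

(** * Images of ideals and dimensions of quotients *)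

Section IdealImages.
Variables (A B : pzRingType) (h : {rmorphism A -> B}).
Hypothesis h_surj : forall b, exists a, h a = b.

Lemma image_ideal_mul (I I' : set A) :
  h @` ideal_mul I I' = ideal_mul (h @` I) (h @` I').
Proof.
apply/seteqP; split=> [_ [x Ix <-]|].
  move: x Ix; apply: (smallest_sub
    (X := [set x | ideal_mul (h @` I) (h @` I') (h x)])).
    split=> [|u v /= Iu Iv]; first by rewrite /= rmorph0 => J [[]].
    by rewrite rmorphB => J JI; case: (JI) => -[_ JB] _; apply: JB;
      [apply: Iu|apply: Iv].
  move=> _ [u Iu [v Iv <-]] /=; rewrite rmorphM.
  apply: sub_gen_smallest; exists (h u); first by exists u.
  by exists (h v); first by exists v.
apply: smallest_sub.
  split=> [|_ _ [u Iu <-] [v Iv <-]].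
    by exists 0; rewrite ?rmorph0// => J [[]].
  exists (u - v); last by rewrite rmorphB.
  by move=> J JI; case: (JI) => -[_ JB] _; apply: JB; [apply: Iu|apply: Iv].
move=> _ [_ [u Iu <-] [_ [v Iv <-] <-]].
exists (u * v); last by rewrite rmorphM.
by apply: sub_gen_smallest; exists u => //; exists v.
Qed.

(** The zeroth power of an ideal is the whole ring, whence surjectivity. *)
Lemma image_ideal_pow (I : set A) n :
  h @` ideal_pow I n = ideal_pow (h @` I) n.
Proof.
elim: n => [|n IHn] /=; last by rewrite image_ideal_mul IHn.
by apply/seteqP; split=> // b _; have [a <-] := h_surj b; exists a.
Qed.

End IdealImages.

Section QuotientDimension.
Variables (R : realType) (K : fieldType) (M : lmodType K).
Implicit Types U V : set M.

(** The coordinates of the [v i] on the [e j] form an [n] by [N] matrix.  If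
    [N < n], a nonzero row of its kernel is a linear dependency between the
    [v i] modulo [V]. *)
Lemma free_le_span V (n N : nat) (v : 'I_n -> M) (e : 'I_N -> M) :
  V 0 -> (forall x y, V x -> V y -> V (x + y)) ->
  (forall a x, V x -> V (a *: x)) ->
  (forall i, exists c : 'I_N -> K, V (v i - \sum_(j < N) c j *: e j)) ->
  free_mod V v -> (n <= N)%N.
Proof.
move=> V0 VD VZ /choice[c Vc] vfree; rewrite leqNgt; apply/negP => ltNn.
pose C : 'M[K]_(n, N) := \matrix_(i, j) c i j.
have kerN0 : kermx C != 0.
  by rewrite kermx_eq0 /row_free neq_ltn (leq_ltn_trans (rank_leq_col C)).
have /matrix0Pn[r [i ker_ri]] := kerN0.
move/eqP: ker_ri; apply; move: i; apply: (vfree (fun i => kermx C r i)).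
have -> : \sum_(i < n) kermx C r i *: v i =
    \sum_(i < n) kermx C r i *: (v i - \sum_(j < N) c i j *: e j).
  under [RHS]eq_bigr do rewrite scalerBr.
  rewrite sumrB [X in _ = _ - X](_ : _ = 0) ?subr0//.
  under eq_bigr do rewrite scaler_sumr.
  rewrite exchange_big big1//= => j _.
  under eq_bigr do rewrite scalerA.
  rewrite -scaler_suml.
  suff -> : \sum_(i < n) kermx C r i * c i j = 0 by rewrite scale0r.
  transitivity ((kermx C *m C) r j); last by rewrite mulmx_ker mxE.
  by rewrite [RHS]mxE; apply: eq_bigr => i _; rewrite [C i j]mxE.
by apply: big_ind => // i _; apply: VZ.
Qed.

Lemma dim_mod_le U V (N : nat) (e : 'I_N -> M) :
  V 0 -> (forall x y, V x -> V y -> V (x + y)) ->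
  (forall a x, V x -> V (a *: x)) ->
  (forall u, U u -> exists c : 'I_N -> K, V (u - \sum_(j < N) c j *: e j)) ->
  (dim_mod R U V <= N%:R%:E)%E.
Proof.
move=> V0 VD VZ Ue; apply: ge_ereal_sup => _ [n [v [Uv vfree]] <-].
rewrite lee_fin ler_nat; apply: (free_le_span V0 VD VZ _ vfree) => i.
exact: Ue.
Qed.

Lemma dim_mod_ge U V (n : nat) (v : 'I_n -> M) :
  (forall i, U (v i)) -> free_mod V v -> (n%:R%:E <= dim_mod R U V)%E.
Proof.
by move=> Uv vfree; apply: ereal_sup_ubound; exists n => //; exists v.
Qed.

(** Any element of [U] outside [V] can be taken as [t], since a second vector
    independent of it would make the dimension at least 2. *)
Lemma dim_mod_le1_gen U V :
  U 0 -> V 0 -> (forall a x, V x -> V (a *: x)) ->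
  (dim_mod R U V <= 1)%E ->
  exists2 t, U t & forall u, U u -> exists c, V (u - c *: t).
Proof.
move=> U0 V0 VZ dim1.
have [UV|] := pselect (U `<=` V).
  by exists 0 => // u Uu; exists 0; rewrite scaler0 subr0; apply: UV.
move=> /existsNP[t /not_implyP[Ut nVt]]; exists t => // u Uu.
apply: contrapT => /forallNP nVu.
pose v (i : 'I_2) := if i == ord0 then t else u.
suff vfree : free_mod V v.
  have Uv i : U (v i) by rewrite /v; case: ifP.
  have := le_trans (dim_mod_ge Uv vfree) dim1.
  by rewrite lee_fin lern1.
move=> c; rewrite !big_ord_recl big_ord0 addr0 /v/=.
set i1 := lift _ _ => Vc.
have c1 : c i1 = 0.
  apply/eqP/contraT => c1N0; case: (nVu (- (c i1)^-1 * c ord0)).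
  rewrite mulNr scaleNr opprK -scalerA addrC.
  by rewrite -[X in _ + X](scalerK c1N0) -scalerDr; apply: VZ.
move: Vc; rewrite c1 scale0r addr0 => Vc.
have c0 : c ord0 = 0.
  by apply/eqP/contraT => c0N0; case: nVt; rewrite -(scalerK c0N0 t); apply: VZ.
by move=> i; case: (unliftP ord0 i) => [j|] ->//; rewrite (ord1 j).
Qed.

End QuotientDimension.

(** * The order filtration *)

Section OrderFiltration.
Variables (K : fieldType) (d : nat).
Local Notation S := (ncseries K d).
Implicit Types (s t u : S) (N : nat).

Lemma nccoefD s t w : (s + t) w = s w + t w. Proof. by []. Qed.
Lemma nccoefN s w : (- s) w = - s w. Proof. by []. Qed.
Lemma nccoefZ (c : K) s w : (c *: s) w = c * s w. Proof. by []. Qed.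
Lemma nccoef1 w : (1 : S) w = (w == [::])%:R. Proof. by []. Qed.
Lemma nccoef_sum (I : Type) (r : seq I) (P : pred I) (F : I -> S) w :
  (\sum_(i <- r | P i) F i) w = \sum_(i <- r | P i) F i w.
Proof. exact: (big_morph (fun s : S => s w)). Qed.
Lemma nccoefM s t w :
  (s * t) w = \sum_(i < (size w).+1) s (take i w) * t (drop i w).
Proof. by []. Qed.
Lemma nccoefM_nil s t : (s * t) [::] = s [::] * t [::].
Proof. exact: ncmul_nil. Qed.

Lemma nccoefM_nseq s t a n :
  (s * t) (nseq n a) = \sum_(i < n.+1) s (nseq i a) * t (nseq (n - i) a).
Proof.
rewrite nccoefM size_nseq; apply: eq_bigr => i _.
by rewrite drop_nseq take_nseq// -ltnS.
Qed.

Lemma order_ge0 s : order_ge 0 s. Proof. by []. Qed.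

Lemma order_geD N s t : order_ge N s -> order_ge N t -> order_ge N (s + t).
Proof. by move=> hs ht w hw; rewrite nccoefD hs// ht// addr0. Qed.

Lemma order_geN N s : order_ge N s -> order_ge N (- s).
Proof. by move=> hs w hw; rewrite nccoefN hs// oppr0. Qed.

Lemma order_geB N s t : order_ge N s -> order_ge N t -> order_ge N (s - t).
Proof. by move=> hs ht; apply/order_geD/order_geN. Qed.

Lemma order_geZ N c s : order_ge N s -> order_ge N (c *: s).
Proof. by move=> hs w hw; rewrite nccoefZ hs// mulr0. Qed.

Lemma order_ge_sum N (I : Type) (r : seq I) (P : pred I) (F : I -> S) :
  (forall i, P i -> order_ge N (F i)) -> order_ge N (\sum_(i <- r | P i) F i).
Proof.
by move=> hF; apply: (big_ind (order_ge N)) => // s t; apply: order_geD.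
Qed.

Lemma order_geW M N s : (N <= M)%N -> order_ge M s -> order_ge N s.
Proof. by move=> leNM hs w hw; apply/hs/(leq_trans hw). Qed.

Lemma order_geM M N s t :
  order_ge M s -> order_ge N t -> order_ge (M + N) (s * t).
Proof.
move=> hs ht w hw; rewrite nccoefM big1// => i _.
have [ltiM|leMi] := ltnP i M.
  by rewrite hs ?mul0r// size_takel// -ltnS.
rewrite ht ?mulr0// size_drop ltn_subLR ?(leq_trans hw) ?leq_add2r//.
by rewrite -ltnS.
Qed.

Lemma order_geMr N s t : order_ge N s -> order_ge N (s * t).
Proof. by move=> hs; rewrite -[N]addn0; apply: order_geM. Qed.

Lemma order_geMl N s t : order_ge N t -> order_ge N (s * t).
Proof. by move=> ht; apply: (order_geM (order_ge0 s)). Qed.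

Lemma order_ge1P s : order_ge 1 s <-> s [::] = 0.
Proof. by split=> [|s0 []//]; apply. Qed.

Lemma order_geX t n : order_ge 1 t -> order_ge n (t ^+ n).
Proof.
by move=> ht; elim: n => // n IHn; rewrite exprS; apply: (order_geM ht).
Qed.

Lemma order_ge_eq0 s : (forall N, order_ge N s) -> s = 0.
Proof. by move=> hs; apply/funext => w; apply: (hs (size w).+1). Qed.

(** Splitting off the last letter writes a series as a finite combination of
    the variables, with coefficients on the left. *)
Lemma last_letter_expand s : s [::] = 0 ->
  s = \sum_(a < d) ((fun w => s (rcons w a)) : S) * ncvar K a.
Proof.
move=> s0; apply/funext => w; rewrite nccoef_sum.
case/lastP: w => [|w b].
  by rewrite s0 big1// => a _; rewrite nccoefM_nil mulr0.
rewrite (bigD1 b)//= [X in _ + X]big1 ?addr0 => [|a neab].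
  rewrite nccoefM size_rcons big_ord_recr big_ord_recr/=.
  rewrite -!cats1 take_size_cat// drop_size_cat// /ncvar eqxx mulr1.
  rewrite drop_oversize ?size_cat ?addn1//= mulr0 addr0.
  rewrite big1 ?add0r// => i _; rewrite drop_cat ltn_ord.
  have: (0 < size (drop i w))%N by rewrite size_drop subn_gt0.
  by case: (drop i w) => [|c [|? ?]]//= _; rewrite eqseq_cons andbF mulr0.
rewrite nccoefM big1// => i _; rewrite /ncvar; case: eqP; rewrite ?mulr0//.
case: (ltnP i (size w).+1) => [ltiw|leiw].
  rewrite drop_rcons// -cats1; case: (drop i w) => [|c [|? ?]]//= [] eba.
  by rewrite eba eqxx in neab.
by rewrite drop_oversize// (leq_trans _ leiw)// size_rcons.
Qed.

(** Since there are finitely many variables, [last_letter_expand] shows that a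
    series of order at least [N.+1] is a finite sum of products of a series of
    order at least [N] and a variable. *)
Lemma ideal_pow_ncmax N : ideal_pow (@ncmax K d) N = @order_ge K d N.
Proof.
elim: N => [|N IHN] /=; first by apply/seteqP; split.
rewrite IHN; apply/seteqP; split.
  apply: smallest_sub; first by split=> // s t; apply: order_geB.
  move=> _ [s hs [t /order_ge1P ht <-]].
  by rewrite -addn1; apply: order_geM.
move=> s hs; rewrite (last_letter_expand (hs _ _))//.
have sub0 : additive_subgroup (ideal_mul (@order_ge K d N) (@ncmax K d)).
  have := ideal_pow_ideal N.+1 (ncmax_ideal K d).
  by rewrite /= IHN => -[[]].
have [I0 IB] := sub0.
apply: big_ind => // [x y Ix Iy|a _].
  by rewrite -[y]opprK; apply: (IB) => //; rewrite -sub0r; apply: IB.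
apply: sub_gen_smallest; exists (fun w => s (rcons w a)) => [w hw|].
  by apply: hs; rewrite size_rcons.
by exists (ncvar K a).
Qed.

Lemma coef_ncvarX a n w : (ncvar K a ^+ n : S) w = (w == nseq n a)%:R.
Proof.
elim: n w => [|n IHn] w; first by rewrite expr0 nccoef1.
rewrite exprS; case: w => [|b w]; first by rewrite nccoefM_nil mul0r.
rewrite nccoefM big_ord_recl/= mul0r add0r big_ord_recl/= take0 drop0 IHn.
rewrite big1 ?addr0 => [|i _]; last first.
  case: w i => [|c w] [i ltiw]//=.
  by rewrite /ncvar/= !eqseq_cons/= andbF mul0r.
by rewrite /ncvar !eqseq_cons andbT; case: eqP => _; rewrite ?mul1r ?mul0r.
Qed.

End OrderFiltration.

(** * Power series in one series without constant term *)

Section Substitution.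
Variables (K : fieldType) (d : nat).
Local Notation S := (ncseries K d).
Implicit Types (s t : S) (p q : nat -> K) (N : nat).

Definition psum t p N : S := \sum_(i < N) p i *: t ^+ i.

(** The infinite sum of the [p i *: t ^+ i].  When [t] has no constant term,
    the powers beyond [size w] do not contribute to the coefficient at [w]. *)
Definition pseval t p : S := fun w => psum t p (size w).+1 w.

Lemma psum_order t p M N : order_ge 1 t -> (M <= N)%N ->
  order_ge M (psum t p N - psum t p M).
Proof.
move=> ht leMN; rewrite /psum -(subnKC leMN) big_split_ord /= addrAC subrr.
rewrite add0r.
apply: order_ge_sum => i _; apply/order_geZ/(order_geW (leq_addr i M)).
exact: order_geX.
Qed.

Lemma pseval_psum t p N : order_ge 1 t -> order_ge N (pseval t p - psum t p N).
Proof.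
move=> ht w hw; have := psum_order p ht hw (ltnSn _).
by rewrite !nccoefD !nccoefN => /subr0_eq E; rewrite /pseval E subrr.
Qed.

Lemma pseval_order t p k : order_ge 1 t -> (forall i, (i < k)%N -> p i = 0) ->
  order_ge k (pseval t p).
Proof.
move=> ht p0; rewrite -[pseval t p](subrK (psum t p k)).
apply: order_geD; first exact: pseval_psum.
by rewrite /psum big1// => i _; rewrite p0 ?scale0r.
Qed.

Lemma psevalD t p q : pseval t (fun i => p i + q i) = pseval t p + pseval t q.
Proof.
apply/funext => w; rewrite nccoefD /pseval /psum -nccoefD -big_split/=.
by congr ((_ : S) w); apply: eq_bigr => i _; rewrite scalerDl.
Qed.

Lemma psevalZ t c p : pseval t (fun i => c * p i) = c *: pseval t p.
Proof.
apply/funext => w; rewrite nccoefZ /pseval /psum -nccoefZ scaler_sumr.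
by congr ((_ : S) w); apply: eq_bigr => i _; rewrite scalerA.
Qed.

Lemma pseval1 t : pseval t (fun i => (i == 0)%:R) = 1.
Proof.
apply/funext => w; rewrite /pseval /psum big_ord_recl big1 => [|i _].
  by rewrite addr0 scale1r.
by rewrite scale0r.
Qed.

Lemma psevalX t : order_ge 1 t -> pseval t (fun i => (i == 1)%:R) = t.
Proof.
move=> ht; apply/eqP; rewrite -subr_eq0; apply/eqP.
apply: order_ge_eq0 => N; apply: (@order_geW _ _ N.+2).
  by rewrite -addn2 leq_addr.
have := pseval_psum (N := N.+2) (fun i => (i == 1)%:R) ht.
rewrite {1}/psum 2!big_ord_recl big1 => [|i _]; last by rewrite scale0r.
by rewrite scale0r scale1r add0r addr0.
Qed.

(** Up to order [N], both sides are values at [t] of truncated polynomials,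
    and the truncation of the convolution differs from the product of the
    truncations by a multiple of ['X^N]. *)
Lemma psevalM t p q : order_ge 1 t ->
  pseval t (fun n => \sum_(i < n.+1) p i * q (n - i)%N) =
  pseval t p * pseval t q.
Proof.
move=> ht; apply/eqP; rewrite -subr_eq0; apply/eqP; apply: order_ge_eq0 => N.
set pq := fun n => _.
pose P r : {poly K} := \poly_(i < N) r i.
have psumE r : psum t r N = horner_alg t (P r).
  rewrite /P poly_def raddf_sum /psum; apply: eq_bigr => i _.
  by rewrite /= linearZ /= rmorphXn /= horner_algX mulr_algl.
have alg_order (r : {poly K}) : (forall i, (i < N)%N -> r`_i = 0) ->
    order_ge N (horner_alg t r).
  move=> r0; rewrite -[r]coefK poly_def raddf_sum; apply: order_ge_sum => i _.
  rewrite /= linearZ /= rmorphXn /= horner_algX mulr_algl.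
  have [ltiN|leNi] := ltnP i N; first by rewrite r0// scale0r.
  exact/order_geZ/(order_geW leNi)/order_geX.
have -> : pseval t pq - pseval t p * pseval t q =
   (pseval t pq - psum t pq N) + (psum t pq N - psum t p N * psum t q N)
   - (pseval t p - psum t p N) * pseval t q
   - psum t p N * (pseval t q - psum t q N).
  rewrite mulrBl mulrBr subrKA -!addrA; congr (_ + _); apply: oppr_inj.
  by rewrite opprK addrA 2!opprD !opprK addrC subrKA addrC subrK.
apply: order_geB; last by apply/order_geMl/pseval_psum.
apply: order_geB; last by apply/order_geMr/pseval_psum.
apply: order_geD; first exact: pseval_psum.
rewrite !psumE -rmorphM -rmorphB; apply: alg_order => n ltnN.
rewrite coefB coefM !coef_poly ltnN; apply/eqP; rewrite subr_eq0; apply/eqP.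
apply: eq_bigr => i _; rewrite !coef_poly.
have -> : (i < N)%N by apply: leq_ltn_trans ltnN; rewrite -ltnS.
by have -> : (n - i < N)%N by apply: leq_ltn_trans ltnN; rewrite leq_subr.
Qed.

(** Up to a scalar [s] is [1 - h] with [h] of order at least 1, and the
    geometric series in [h] is an inverse. *)
Lemma ncseries_left_inverse s : s [::] != 0 -> exists s', s' * s = 1.
Proof.
move=> s0; pose c := s [::]; pose h : S := 1 - c^-1 *: s.
have hh : order_ge 1 h.
  by apply/order_ge1P; rewrite /h nccoefD nccoefN nccoefZ nccoef1 mulVf// subrr.
exists (c^-1 *: pseval h (fun=> 1)).
have -> : s = c *: (1 - h) by rewrite opprB addrC subrK scalerA divff ?scale1r.
rewrite -scalerAl -scalerAr scalerA mulVf// scale1r.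
have {2}-> : h = pseval h (fun i => (i == 1)%:R) by rewrite psevalX.
rewrite mulrBr mulr1 -psevalM//.
rewrite -scaleN1r -psevalZ -psevalD -(pseval1 h); congr pseval.
apply/funext => -[|n]; first by rewrite big_ord1 mulr0 mulr0 addr0.
rewrite !big_ord_recr/= subnn subSnn !mulr0 addr0 mul1r mulN1r.
rewrite big1 ?add0r ?subrr// => i _; rewrite subSn 1?ltnW// eqSS subn_eq0.
by rewrite leqNgt ltn_ord mulr0.
Qed.

End Substitution.

(** * The Jacobi algebra and its generators *)

(** Noncommutativity puts identities between series out of reach of [ring],
    but once the products are expanded they hold coefficientwise in [K]. *)
Ltac series_additive :=
  apply/funext => ?; rewrite !(nccoefD, nccoefN, nccoefZ); ring.

Section JacobiAlgebra.
Variables (K : fieldType) (d : nat).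
Local Notation S := (ncseries K d).
Implicit Types (f g s t a : S) (N k : nat).

Lemma jacobian_set0 f : jacobian_set f 0.
Proof. by case: (tsidealP (jacobian_ideal f)) => -[[]]. Qed.

Lemma jacobian_setB f s t :
  jacobian_set f s -> jacobian_set f t -> jacobian_set f (s - t).
Proof. by case: (tsidealP (jacobian_ideal f)) => -[[_ +] _] _; apply. Qed.

Lemma jacobian_setN f s : jacobian_set f s -> jacobian_set f (- s).
Proof. by move=> Is; rewrite -sub0r; apply/jacobian_setB/Is/jacobian_set0. Qed.

Lemma jacobian_setD f s t :
  jacobian_set f s -> jacobian_set f t -> jacobian_set f (s + t).
Proof.
by move=> Is It; rewrite -[t]opprK; apply/jacobian_setB/jacobian_setN.
Qed.

Lemma jacobian_setMl f s t : jacobian_set f t -> jacobian_set f (s * t).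
Proof. by case: (tsidealP (jacobian_ideal f)) => -[_ +] _; apply. Qed.

Lemma jacobian_setMr f s t : jacobian_set f s -> jacobian_set f (s * t).
Proof. by case: (tsidealP (jacobian_ideal f)) => _; apply. Qed.

Lemma jacobian_setZ f c s : jacobian_set f s -> jacobian_set f (c *: s).
Proof. by move=> Is; rewrite -mulr_algl; apply: jacobian_setMl. Qed.

Lemma derivative_jacobian f i : jacobian_set f (cyclic_derivative i f).
Proof.
move=> N _; exists (cyclic_derivative i f).
  by apply: sub_gen_smallest; exists i.
by exists 0; rewrite ?addr0// ideal_pow_ncmax.
Qed.

(** Closedness for the topology defined by the powers of the maximal ideal,
    which are the sets of series of order at least [N]. *)
Definition ncclosed (X : set S) :=
  forall s, (forall N, exists2 x, X x & order_ge N (s - x)) -> X s.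

Lemma jacobian_closed f : ncclosed (jacobian_set f).
Proof.
move=> s Is N _; have [a Ia sa] := Is N; have [b Ib [h]] := Ia N Logic.I.
rewrite ideal_pow_ncmax => hN ab; exists b => //.
exists (h + (s - a)); first by apply: order_geD.
by rewrite addrA ab addrC subrK.
Qed.

(** The way to bound the Jacobian ideal from above: each use picks a set of
    series defined by conditions on finitely many coefficients at a time, which
    is therefore closed. *)
Lemma jacobian_least f (X : set S) :
  two_sided_ideal X -> ncclosed X ->
  (forall i, X (cyclic_derivative i f)) -> jacobian_set f `<=` X.
Proof.
move=> Xid Xcl Xd s Is; apply: Xcl => N; have [b Ib [h]] := Is N Logic.I.
rewrite ideal_pow_ncmax => hN <-; exists b; last by rewrite addrC addKr.
by apply: Ib; split=> // _ [i _ <-]; apply: Xd.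
Qed.

Lemma jacobian_order1 f s : order_ge 2 f -> jacobian_set f s -> order_ge 1 s.
Proof.
move=> hf Is; apply/order_ge1P; move: s Is.
apply: (jacobian_least (X := @ncmax K d)); first exact: ncmax_ideal.
  move=> s /(_ 1%N)[x x0 sx]; rewrite /ncmax/= -[s](subrK x) nccoefD sx//.
  by rewrite add0r.
move=> i; rewrite /ncmax/= /cyclic_derivative/= big1// => m _.
by rewrite big1// => j _;  rewrite hf// size_tuple.
Qed.

Definition jpi f s : Jac f := (\pi_(quot_alg (jacobian_ideal f)) s)%qT.

Fact jpi_zmod f : zmod_morphism (jpi f).
Proof.
move=> s t; have piD := @qpi_add _ _ (jacobian_ideal f).
by apply/eqP; rewrite eq_sym subr_eq; apply/eqP; rewrite /jpi -piD subrK.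
Qed.

Fact jpi_monoid f : monoid_morphism (jpi f).
Proof.
by split=> // s t; rewrite /jpi -(@quot_mulE _ _ (jacobian_ideal f)).
Qed.

HB.instance Definition _ f :=
  GRing.isZmodMorphism.Build _ _ (jpi f) (jpi_zmod f).
HB.instance Definition _ f :=
  GRing.isMonoidMorphism.Build _ _ (jpi f) (jpi_monoid f).

Lemma jpiZ f : scalable (jpi f).
Proof. by move=> c s; rewrite /jpi -(@quot_scaleE _ _ (jacobian_ideal f)). Qed.

Lemma jpi_surj f (u : Jac f) : exists s, jpi f s = u.
Proof.
by exists (repr u)%qT; apply: (@reprK _ (quot_alg (jacobian_ideal f))).
Qed.

Lemma jpi_eq f s t : jpi f s = jpi f t <-> jacobian_set f (s - t).
Proof. exact: (quot_algE (jacobian_ideal f)). Qed.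

Lemma jpi_eq0 f s : jpi f s = 0 <-> jacobian_set f s.
Proof. by rewrite -(rmorph0 (jpi f)) jpi_eq subr0. Qed.

(** Series with nonzero constant term are units, so every proper left ideal
    lies in the image of the series without constant term.  This image is
    proper because the Jacobian ideal contains no unit. *)
Lemma jac_radicalE f : order_ge 2 f ->
  jacobson_radical (Jac f) = jpi f @` @ncmax K d.
Proof.
move=> hf; set P := _ @` _.
have [[n0 nB] nMl] : left_ideal (@ncmax K d) by case: (ncmax_ideal K d).
have P1 : ~ P 1.
  move=> [s s0]; rewrite -(rmorph1 (jpi f)) => /jpi_eq/(jacobian_order1 hf).
  move/order_ge1P; rewrite nccoefD nccoefN nccoef1 s0 sub0r.
  by move/eqP; rewrite oppr_eq0 oner_eq0.
have Pideal : left_ideal P.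
  split; first split; first by exists 0; rewrite ?rmorph0.
  - move=> _ _ [s s0 <-] [t t0 <-].
    by exists (s - t); rewrite ?rmorphB//; apply: nB.
  - move=> b _ [s s0 <-]; have [t <-] := jpi_surj b.
    by exists (t * s); rewrite ?rmorphM//; apply: nMl.
have Pmax J : left_ideal J -> J <> setT -> J `<=` P.
  move=> [[_ _] JMl] JT u Ju; have [s su] := jpi_surj u.
  exists s => //; apply/eqP/contraT => /ncseries_left_inverse[s' ss'].
  case: JT; apply/seteqP; split=> // v _.
  by rewrite -[v]mulr1 -(rmorph1 (jpi f)) -ss' rmorphM/= su; do 2 apply: (JMl).
apply/seteqP; split=> [u|u Pu J [Jid JT Jmax]].
  apply; split=> // [PT|J Jid PJ]; first by apply: P1; rewrite PT.
  have [->|JT] := pselect (J = setT); first by right.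
  by left; apply/seteqP; split=> //; apply: Pmax.
have [<-//|PT] := Jmax P Pideal (Pmax _ Jid JT).
by case: P1; rewrite PT.
Qed.

(** Unlike [jac_radicalE], this description of the radical is visibly
    preserved by ring isomorphisms. *)
Lemma jac_radical_nonunit f (u : Jac f) : order_ge 2 f ->
  jacobson_radical (Jac f) u <-> forall v, v * u <> 1.
Proof.
move=> hf; have [s <-] := jpi_surj u; rewrite (jac_radicalE hf); split.
  move=> [r r0 /esym rE] v; have [q <-] := jpi_surj v.
  rewrite rE -rmorphM -(rmorph1 (jpi f)).
  move=> /jpi_eq/(jacobian_order1 hf)/order_ge1P.
  rewrite nccoefD nccoefN nccoefM_nil r0 mulr0 nccoef1 sub0r => /eqP.
  by rewrite oppr_eq0 oner_eq0.
move=> nu; exists s => //; apply/eqP/contraT => /ncseries_left_inverse[r rs].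
by case: (nu (jpi f r)); rewrite -rmorphM rs rmorph1.
Qed.

Lemma jac_radical_pow f N s : order_ge 2 f ->
  ideal_pow (jacobson_radical (Jac f)) N (jpi f s) <->
  exists2 a, jacobian_set f a & order_ge N (s - a).
Proof.
move=> hf; rewrite (jac_radicalE hf) -image_ideal_pow; last exact: jpi_surj.
rewrite ideal_pow_ncmax; split=> [[s' hs' /esym/jpi_eq Is]|[a Ia hsa]].
  by exists (s - s'); rewrite // opprB addrC subrK.
by exists (s - a); rewrite // rmorphB/= (jpi_eq0 f a).2// subr0.
Qed.

(** The class of [t] spans the radical modulo its square; by completeness it
    then generates the Jacobi algebra topologically. *)
Definition jac_generator f t :=
  order_ge 1 t /\ forall s, order_ge 1 s ->
    exists c, exists2 a, jacobian_set f a & order_ge 2 (s - c *: t - a).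

(** By induction on [k]: write [s] as a sum of products [u * x_b], expand [u]
    along [t ^+ k] and the variable [x_b] along [t], and multiply. *)
Lemma generator_power f t k s : jac_generator f t -> order_ge k s ->
  exists c, exists2 a, jacobian_set f a & order_ge k.+1 (s - c *: t ^+ k - a).
Proof.
move=> [ht gent]; elim: k s => [|k IHk] s hs.
  exists (s [::]), 0; first exact: jacobian_set0.
  apply/order_ge1P; rewrite subr0 nccoefD nccoefN nccoefZ expr0 nccoef1 mulr1.
  by rewrite subrr.
rewrite (last_letter_expand (hs _ _))//.
apply: (big_ind (fun s => exists c, exists2 a, jacobian_set f a &
    order_ge k.+2 (s - c *: t ^+ k.+1 - a))).
- exists 0, 0; first exact: jacobian_set0.
  by rewrite scale0r !subr0.
- move=> u v [c [a Ia hu]] [e [b Ib hv]].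
  exists (c + e), (a + b); first exact: jacobian_setD.
  have -> : u + v - (c + e) *: t ^+ k.+1 - (a + b) =
      (u - c *: t ^+ k.+1 - a) + (v - e *: t ^+ k.+1 - b) by series_additive.
  exact: order_geD.
move=> b _; set u : S := fun w : seq (ordinal d) => s (rcons w b).
have [|c [a Ia hu]] := IHk u.
  by move=> w hw; apply: hs; rewrite size_rcons.
have [|e [a' Ia' hv]] := gent (ncvar K b); first exact/order_ge1P.
set r := _ - _ in hu; set r' := _ - _ in hv.
exists (c * e), (c *: t ^+ k * a' + a * ncvar K b).
  by apply: jacobian_setD; [apply: jacobian_setMl|apply: jacobian_setMr].
have -> : u * ncvar K b - (c * e) *: t ^+ k.+1 -
    (c *: t ^+ k * a' + a * ncvar K b) = c *: t ^+ k * r' + r * ncvar K b.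
  rewrite /r /r' !mulrBl !mulrBr -!scalerAl -!scalerAr -exprSr.
  series_additive.
apply: order_geD.
  rewrite -addn2; apply: order_geM hv; exact/order_geZ/order_geX.
by rewrite -addn1; apply: order_geM => //; apply/order_ge1P.
Qed.

(** Successive approximation: at step [k], [generator_power] removes a multiple
    of [t ^+ k] and an element of the ideal from a remainder of order [k], and
    leaves one of order [k.+1].  The total error is in the ideal because the
    ideal is closed. *)
Lemma generator_expand f t s : jac_generator f t ->
  exists p, jacobian_set f (s - pseval t p).
Proof.
move=> gent; have [ht _] := gent.
(* The step is made total, returning (0, 0) on a remainder of low order, so
   that it can be chosen as a function and iterated. *)
have /choice[C] : forall ks : nat * S, exists cr : K * S,
    order_ge ks.1 ks.2 -> order_ge ks.1.+1 cr.2 /\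
    jacobian_set f (ks.2 - cr.1 *: t ^+ ks.1 - cr.2).
  move=> [k u]; have [hu|] := pselect (order_ge k u); last by exists (0, 0).
  have [c [a Ia ha]] := generator_power gent hu.
  by exists (c, u - c *: t ^+ k - a) => _ /=; rewrite subKr.
move=> CP.
pose rem := fix rem k := if k is k'.+1 then (C (k', rem k')).2 else s.
pose p k := (C (k, rem k)).1.
have rem_order k : order_ge k (rem k).
  by elim: k => // k IHk; have [] := CP (k, rem k) IHk.
exists p; apply: jacobian_closed => N.
have {}CP k := (CP (k, rem k) (rem_order k)).2.
have IN : jacobian_set f (s - psum t p N - rem N).
  elim: N => [|N IHN].
    by rewrite /psum big_ord0 subr0 subrr; apply: jacobian_set0.
  rewrite /psum big_ord_recr/= -/(psum t p N).
  have := jacobian_setD IHN (CP N).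
  rewrite /= -[(C _).2]/(rem N.+1) -[(C _).1]/(p N).
  congr (jacobian_set f); series_additive.
exists (s - psum t p N - rem N) => //.
have -> : s - pseval t p - (s - psum t p N - rem N) =
    rem N - (pseval t p - psum t p N) by series_additive.
by apply: order_geB => //; apply: pseval_psum.
Qed.

(** Equivalently, [t ^+ i] is zero in the Jacobi algebra when [t] is a generator
    (see [power_annihilates]).  This form, up to terms of order greater than
    [i], can be read off from leading terms. *)
Definition power_vanishes f t i :=
  exists2 a, jacobian_set f a & order_ge i.+1 (t ^+ i - a).

(** If [t ^+ k] has order greater than [k] modulo the ideal, then multiplying
    by [t ^+ (m - k)] shows the same for all [m >= k], so by [generator_power]
    the order of [s] can be raised indefinitely modulo the closed ideal. *)
Lemma power_annihilates f t k s : jac_generator f t -> power_vanishes f t k ->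
  order_ge k s -> jacobian_set f s.
Proof.
move=> gent [a0 Ia0 ha0].
have step m u : (k <= m)%N -> order_ge m u ->
    exists2 a, jacobian_set f a & order_ge m.+1 (u - a).
  move=> lekm /(generator_power gent)[c [a Ia ha]].
  exists (c *: (a0 * t ^+ (m - k)) + a).
    by apply: jacobian_setD => //; apply/jacobian_setZ/jacobian_setMr.
  have -> : u - (c *: (a0 * t ^+ (m - k)) + a) = (u - c *: t ^+ m - a) +
      c *: ((t ^+ k - a0) * t ^+ (m - k)).
    by rewrite mulrBl -exprD subnKC//; series_additive.
  apply: order_geD => //; apply: order_geZ; rewrite -(subnKC lekm) -addSn.
  rewrite [X in order_ge _ (_ * t ^+ X)]addKn; apply: order_geM => //.
  by case: gent => ht _; apply: order_geX.
move=> hs; apply: jacobian_closed => N.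
suff [a Ia ha] : exists2 a, jacobian_set f a & order_ge (k + N) (s - a).
  by exists a => //; apply/(order_geW _ ha)/leq_addl.
elim: N => [|N [a Ia ha]].
  by exists 0; rewrite ?addn0 ?subr0//; apply: jacobian_set0.
have [b Ib hb] := step _ _ (leq_addr _ _) ha.
exists (a + b); first exact: jacobian_setD.
by rewrite addnS opprD addrA.
Qed.

(** At the least [i] with [p i] nonzero, [pseval t p] is [p i *: t ^+ i] up to
    terms of order greater than [i]. *)
Lemma pseval_jacobian_coef f t k p : order_ge 1 t ->
  (forall i, (i < k)%N ->
     ~ power_vanishes f t i) ->
  jacobian_set f (pseval t p) -> forall i, (i < k)%N -> p i = 0.
Proof.
move=> ht nt Ip i; elim/ltn_ind: i => i IHi ltik; apply/eqP/contraT => pi0.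
case: (nt i ltik); exists ((p i)^-1 *: pseval t p); first exact: jacobian_setZ.
rewrite -[t ^+ i](scalerK pi0) -scalerBr; apply: order_geZ.
rewrite -opprB; apply: order_geN.
have -> : p i *: t ^+ i = psum t p i.+1.
  rewrite /psum big_ord_recr/= big1 ?add0r// => j _.
  by rewrite IHi ?scale0r// (ltn_trans (ltn_ord j)).
exact: pseval_psum.
Qed.

End JacobiAlgebra.

(** * Cyclic derivatives *)

Section CyclicDerivative.
Variables (K : fieldType) (d : nat).
Local Notation S := (ncseries K d).
Implicit Types (f g s t : S) (i a b : 'I_d).

(** Rotating and removing a letter at position [j] is undone by cutting [w] at
    [size w - j] and inserting the letter between the two swapped halves. *)
Lemma cyclic_cut_eq i (m w : seq 'I_d) j : (j <= size w)%N ->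
  size m = (size w).+1 ->
  (nth i m j == i) && (drop j.+1 m ++ take j m == w) =
  (m == drop (size w - j) w ++ i :: take (size w - j) w).
Proof.
move=> lejw sm; set k := (size w - j)%N.
have jm : (j < size m)%N by rewrite sm.
apply/andP/eqP => [[/eqP mj /eqP mw]|->].
  have szd : size (drop j.+1 m) = k by rewrite size_drop sm subSS.
  rewrite -mw -szd drop_size_cat// take_size_cat// -[i in i :: _]mj.
  by rewrite -drop_nth ?cat_take_drop.
have szd : size (drop k w) = j by rewrite size_drop subKn.
rewrite nth_cat szd ltnn subnn /= eqxx; split => //.
rewrite take_size_cat// -cat_rcons drop_size_cat ?size_rcons ?szd//.
by rewrite cat_take_drop.
Qed.

Lemma cyclic_derivativeE i f w : cyclic_derivative i f w =
  \sum_(k < (size w).+1) f (drop k w ++ i :: take k w).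
Proof.
rewrite /cyclic_derivative (exchange_big_dep xpredT)//=.
rewrite [RHS](reindex_inj rev_ord_inj)/=; apply: eq_bigr => j _; rewrite subSS.
set k := (size w - j)%N.
have lejw : (j <= size w)%N by rewrite -ltnS.
have lekw : (k <= size w)%N by rewrite leq_subr.
have sz : size (drop k w ++ i :: take k w) == (size w).+1.
  by rewrite size_cat/= size_drop size_takel// addnS subnK.
rewrite (big_pred1 (Tuple sz)) => // m /=.
by rewrite (tnth_nth i) cyclic_cut_eq ?size_tuple.
Qed.

Lemma cyclic_derivativeD i : {morph @cyclic_derivative K d i : f g / f + g}.
Proof.
move=> f g; apply/funext => w; rewrite nccoefD !cyclic_derivativeE -big_split.
exact: eq_bigr.
Qed.

Lemma cyclic_derivative0 i : cyclic_derivative i (0 : S) = 0.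
Proof. by apply/funext => w; rewrite cyclic_derivativeE big1. Qed.

(** Of the words [drop k w ++ i :: take k w], either all or none are powers of
    the letter [a]; this produces the factor [n.+1]. *)
Lemma cyclic_derivative_varX i a n :
  cyclic_derivative i (ncvar K a ^+ n.+1 : S) =
  if i == a then n.+1%:R *: ncvar K a ^+ n else 0.
Proof.
apply/funext => w; rewrite cyclic_derivativeE.
have E k : (drop k w ++ i :: take k w == nseq n.+1 a) =
    (i == a) && (w == nseq n a).
  apply/eqP/andP => [E|[/eqP-> /eqP->]].
    have : all (pred1 a) (i :: take k w ++ drop k w).
      by rewrite -cat_cons all_cat andbC -all_cat E all_nseq /= eqxx.
    rewrite cat_take_drop /= => /andP[-> /all_pred1P ->].
    have := congr1 size E; rewrite size_cat/= addnS addnC -size_cat.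
    by rewrite cat_take_drop size_nseq => -[->].
  rewrite drop_nseq; have [ltkn|lenk] := ltnP k n.
    rewrite take_nseq ?(ltnW ltkn)// -[a :: _]/(nseq k.+1 a) -nseqD addnS.
    by rewrite subnK// ltnW.
  rewrite take_oversize ?size_nseq//.
  by move: lenk; rewrite -subn_eq0 => /eqP->.
under eq_bigr do rewrite coef_ncvarX E.
case: eqP => [<-|_] /=; last by rewrite big1.
rewrite nccoefZ coef_ncvarX sumr_const card_ord.
by case: eqP => [->|_]; rewrite ?size_nseq ?mulr1// mul0rn mulr0.
Qed.

End CyclicDerivative.

(** * Classification by the length *)

Section CyclicQuotients.
Variables (K : fieldType) (d : nat).
Local Notation S := (ncseries K d).
Implicit Types (f g s t : S).

Lemma jac_iso_intro f g (phi : Jac f -> Jac g) :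
  zmod_morphism phi -> monoid_morphism phi -> scalable phi -> bijective phi ->
  jac_iso f g.
Proof.
move=> phiB phiM phiZ phibij.
pose Phi : {rmorphism Jac f -> Jac g} := HB.pack phi
  (GRing.isZmodMorphism.Build _ _ phi phiB)
  (GRing.isMonoidMorphism.Build _ _ phi phiM).
by exists Phi.
Qed.

Lemma jac_iso_sym f g : jac_iso f g -> jac_iso g f.
Proof.
move=> [phi [phiZ [psi phiK psiK]]]; apply: (@jac_iso_intro g f psi).
- by move=> u v; rewrite -[u in LHS]psiK -[v in LHS]psiK -rmorphB phiK.
- split=> [|u v]; first by rewrite -(rmorph1 phi) phiK.
  by rewrite -[u in LHS]psiK -[v in LHS]psiK -rmorphM phiK.
- by move=> c u; rewrite -[u in LHS]psiK -phiZ phiK.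
- by exists phi.
Qed.

(** The first isomorphism theorem, for a map given at the level of series. *)
Lemma jac_iso_of_surjection f g (Phi : S -> S) :
  zmod_morphism Phi -> monoid_morphism Phi -> scalable Phi ->
  (forall s, exists u, jacobian_set f (s - Phi u)) ->
  (forall s, jacobian_set f (Phi s) <-> jacobian_set g s) ->
  jac_iso g f.
Proof.
move=> PhiB [Phi1 PhiM] PhiZ Phisurj Phiker.
pose phi (u : Jac g) : Jac f := jpi f (Phi (repr u)%qT).
have phiE s : phi (jpi g s) = jpi f (Phi s).
  by apply/jpi_eq; rewrite -PhiB; apply/Phiker/jpi_eq/reprK.
apply: (@jac_iso_intro g f phi).
- move=> u v; have [s <-] := jpi_surj u; have [t <-] := jpi_surj v.
  by rewrite -rmorphB !phiE PhiB rmorphB.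
- split=> [|u v]; first by rewrite -(rmorph1 (jpi g)) phiE Phi1 rmorph1.
  have [s <-] := jpi_surj u; have [t <-] := jpi_surj v.
  by rewrite -rmorphM !phiE PhiM rmorphM.
- by move=> c u; have [s <-] := jpi_surj u; rewrite -jpiZ !phiE PhiZ jpiZ.
have phi_inj : injective phi.
  move=> u v; have [s <-] := jpi_surj u; have [t <-] := jpi_surj v.
  by rewrite !phiE => /jpi_eq; rewrite -PhiB => /Phiker/jpi_eq.
have /choice[psi psiK] v : exists u, phi u = v.
  have [s <-] := jpi_surj v; have [u su] := Phisurj s.
  by exists (jpi g u); rewrite phiE; apply/esym/jpi_eq.
by exists psi => // u; apply: phi_inj; rewrite psiK.
Qed.

Lemma power_vanishesW f t i j : order_ge 1 t -> (i <= j)%N ->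
  power_vanishes f t i -> power_vanishes f t j.
Proof.
move=> ht leij [a Ia ha]; exists (a * t ^+ (j - i)).
  exact: jacobian_setMr.
have -> : t ^+ j - a * t ^+ (j - i) = (t ^+ i - a) * t ^+ (j - i).
  by rewrite mulrBl -exprD subnKC.
have -> : j.+1 = (i.+1 + (j - i))%N by rewrite addSn subnKC.
by apply: order_geM => //; apply: order_geX.
Qed.

(** The kernel of the map from one-variable power series to the Jacobi algebra:
    it is generated by the least power of [t] that vanishes, or is zero. *)
Lemma pseval_jacobian f t p : jac_generator f t ->
  jacobian_set f (pseval t p) <->
  (forall i, ~ power_vanishes f t i -> p i = 0).
Proof.
move=> gent; have [ht _] := gent; split=> [Ip i nvi|p0].
  apply: (pseval_jacobian_coef ht _ Ip (ltnSn i)) => j leji vj.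
  by apply: nvi; apply: power_vanishesW vj.
have [[k vk]|nv] := pselect (exists k, power_vanishes f t k); last first.
  have -> : pseval t p = 0 by apply: order_ge_eq0 => N;
    apply: pseval_order => // i _; apply: p0 => vi; apply: nv; exists i.
  exact: jacobian_set0.
have ex : exists k, `[< power_vanishes f t k >] by exists k; apply/asboolP.
case: (ex_minnP ex) => {vk}k /asboolP vk kmin.
apply: (power_annihilates gent vk); apply: pseval_order => // i ltik.
by apply: p0 => /asboolP/kmin; rewrite leqNgt ltik.
Qed.

Lemma pseval_commutes t p q : order_ge 1 t ->
  pseval t p * pseval t q = pseval t q * pseval t p.
Proof.
move=> ht; rewrite -!psevalM//; congr pseval; apply/funext => n.
rewrite (reindex_inj rev_ord_inj); apply: eq_bigr => i _ /=.
by rewrite subSS subKn 1?mulrC// -ltnS.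
Qed.

Lemma generator_commutative f t : jac_generator f t ->
  forall u v : Jac f, u * v = v * u.
Proof.
move=> gent u v; have [ht _] := gent.
have [s <-] := jpi_surj u; have [s' <-] := jpi_surj v.
have [p /jpi_eq ->] := generator_expand s gent.
have [q /jpi_eq ->] := generator_expand s' gent.
by rewrite -!rmorphM (pseval_commutes _ _ ht).
Qed.

(** Each [nseq i y] stands for the monomial [y^i].  The set [live] of exponents
    is meant to be an initial segment of [nat], possibly infinite. *)
Definition axis_ideal (y : 'I_d) (live : nat -> Prop) : set S :=
  [set s | forall i, live i -> s (nseq i y) = 0].

Lemma pseval_axis (y : 'I_d) (p : nat -> K) i :
  (pseval (ncvar K y) p : S) (nseq i y) = p i.
Proof.
rewrite /pseval /psum size_nseq nccoef_sum big_ord_recr/= big1 => [|j _].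
  by rewrite add0r nccoefZ coef_ncvarX eqxx mulr1.
rewrite nccoefZ coef_ncvarX; case: eqP; rewrite ?mulr0// => /(congr1 size).
by rewrite !size_nseq => E; have := ltn_ord j; rewrite -E ltnn.
Qed.

(** That [live] is an initial segment makes [axis_ideal] an ideal, and it is
    closed, which gives one inclusion.  For the other one, a series is a power
    series in [y] modulo the ideal, and membership is decided by the
    coefficients of this power series. *)
Lemma jacobian_axis g y (live : nat -> Prop) :
  jac_generator g (ncvar K y) ->
  (forall i j, (i <= j)%N -> live j -> live i) ->
  (forall i, axis_ideal y live (cyclic_derivative i g)) ->
  (forall i, ~ live i -> power_vanishes g (ncvar K y) i) ->
  jacobian_set g = axis_ideal y live.
Proof.
move=> geny livedown der dead.
have sub : jacobian_set g `<=` axis_ideal y live.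
  apply: jacobian_least => //.
    split; first split; first split=> // s t Xs Xt i li.
    - by rewrite nccoefD nccoefN Xs// Xt// subrr.
    - move=> u s Xs i li; rewrite nccoefM_nseq big1// => j _.
      by rewrite Xs ?mulr0//; apply: livedown li; rewrite leq_subr.
    - move=> u s Xs i li; rewrite nccoefM_nseq big1// => j _.
      by rewrite Xs ?mul0r//; apply: livedown li; rewrite -ltnS.
  move=> s Xs i li; have [x Xx sx] := Xs i.+1.
  by rewrite -[s](subrK x) nccoefD sx ?size_nseq// Xx// addr0.
apply/seteqP; split=> // s Xs; have [p sp] := generator_expand s geny.
rewrite -[s](subrK (pseval (ncvar K y) p)); apply: jacobian_setD => //.
apply/(pseval_jacobian _ geny) => i nvi.
have li : live i by apply: contrapT => /dead.
have := sub _ sp i li; rewrite nccoefD nccoefN pseval_axis Xs// sub0r.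
by move/eqP; rewrite oppr_eq0 => /eqP.
Qed.

(** The isomorphism substitutes [t] for [y] and 0 for the other variables. *)
Lemma jac_iso_axis f t g y live :
  jac_generator f t -> (forall i, live i <-> ~ power_vanishes f t i) ->
  jacobian_set g = axis_ideal y live -> jac_iso f g.
Proof.
move=> gent liveE Ig; have [ht _] := gent; apply: jac_iso_sym.
apply: (jac_iso_of_surjection
  (Phi := fun s => pseval t (fun i => s (nseq i y)))).
- move=> s s'; apply/esym/eqP; rewrite subr_eq -psevalD; apply/eqP.
  by congr pseval; apply/funext => i; rewrite nccoefD nccoefN subrK.
- split=> [|s s'].
    rewrite -[RHS](pseval1 t); congr pseval; apply/funext => i.
    by rewrite nccoef1 -size_eq0 size_nseq.
  rewrite -psevalM//; congr pseval; apply/funext => i; exact: nccoefM_nseq.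
- by move=> c s; rewrite -psevalZ.
- move=> s; have [p sp] := generator_expand s gent.
  exists (fun w => p (size w)).
  rewrite [X in pseval t X](_ : _ = p)//.
  by apply/funext => i; rewrite size_nseq.
move=> s; rewrite (pseval_jacobian _ gent) Ig.
by split=> sz i /liveE; apply: sz.
Qed.

End CyclicQuotients.

(** * Corank and growth *)

Section Dimensions.
Variables (R : realType) (K : fieldType) (d : nat).
Local Notation S := (ncseries K d).
Local Notation rad f := (jacobson_radical (Jac f)).
Implicit Types (f g s t : S).

Section RadicalPowers.
Variables (f : S) (hf : order_ge 2 f) (N : nat).

Lemma radical_pow0 : ideal_pow (rad f) N 0.
Proof.
rewrite -(rmorph0 (jpi f)); apply/(jac_radical_pow _ _ hf).
by exists 0; [exact: jacobian_set0|rewrite subr0].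
Qed.

Lemma radical_powD x y :
  ideal_pow (rad f) N x -> ideal_pow (rad f) N y -> ideal_pow (rad f) N (x + y).
Proof.
have [s <-] := jpi_surj x; have [t <-] := jpi_surj y; rewrite -rmorphD.
move=> /(jac_radical_pow _ _ hf)[a Ia ha] /(jac_radical_pow _ _ hf)[b Ib hb].
apply/(jac_radical_pow _ _ hf); exists (a + b); first exact: jacobian_setD.
by rewrite opprD addrACA; apply: order_geD.
Qed.

Lemma radical_powZ c x : ideal_pow (rad f) N x -> ideal_pow (rad f) N (c *: x).
Proof.
have [s <-] := jpi_surj x; rewrite -jpiZ => /(jac_radical_pow _ _ hf)[a Ia ha].
apply/(jac_radical_pow _ _ hf); exists (c *: a); first exact: jacobian_setZ.
by rewrite -scalerBr; apply: order_geZ.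
Qed.

End RadicalPowers.

(** A generator is a lift of a vector spanning the radical modulo its square;
    it may be zero there, when the corank is zero. *)
Lemma dim_cotangent_le1 f : order_ge 2 f ->
  (dim_mod R (rad f) (ideal_pow (rad f) 2) <= 1)%E <->
  exists t, jac_generator f t.
Proof.
move=> hf; have J0 : rad f 0.
  by rewrite (jac_radicalE hf); exists 0; rewrite ?rmorph0.
split=> [dim1|[t [ht gent]]].
  have [x] :=
    dim_mod_le1_gen J0 (radical_pow0 hf 2) (@radical_powZ _ hf 2) dim1.
  rewrite {1}(jac_radicalE hf) => -[t t0 <-] gent.
  exists t; split=> [|s /order_ge1P s0]; first exact/order_ge1P.
  have [|c] := gent (jpi f s); first by rewrite (jac_radicalE hf); exists s.
  rewrite -jpiZ -rmorphB => /(jac_radical_pow _ _ hf)[a Ia ha].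
  by exists c, a.
apply: (dim_mod_le (N := 1) R (e := fun=> jpi f t)).
- exact: radical_pow0.
- exact: radical_powD.
- exact: radical_powZ.
move=> u; rewrite {1}(jac_radicalE hf) => -[s /order_ge1P s0 <-].
have [c [a Ia ha]] := gent s s0.
exists (fun=> c); rewrite big_ord1 -jpiZ -rmorphB.
by apply/(jac_radical_pow _ _ hf); exists a.
Qed.

Lemma generator_dim f t N : order_ge 2 f -> jac_generator f t ->
  (dim_mod R setT (ideal_pow (rad f) N) <= N%:R%:E)%E.
Proof.
move=> hf gent; have [ht _] := gent.
apply: (dim_mod_le R (e := fun i : 'I_N => jpi f (t ^+ i))).
- exact: radical_pow0.
- exact: radical_powD.
- exact: radical_powZ.
move=> u _; have [s <-] := jpi_surj u.
have [p sp] := generator_expand s gent; exists (fun i => p i).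
under eq_bigr do rewrite -jpiZ.
rewrite -rmorph_sum -rmorphB; apply/(jac_radical_pow _ _ hf).
exists (s - pseval t p) => //; rewrite opprB addrC addrA subrK.
exact: pseval_psum.
Qed.

Lemma generator_jac_dim f t k : jac_generator f t -> power_vanishes f t k ->
  (dim_mod R (setT : set (Jac f)) [set 0%R] <= k%:R%:E)%E.
Proof.
move=> gent vk; have [ht _] := gent.
apply: (dim_mod_le R (e := fun i : 'I_k => jpi f (t ^+ i))) => //.
- by move=> x y -> ->; rewrite /= addr0.
- by move=> a x ->; rewrite /= scaler0.
move=> u _; have [s <-] := jpi_surj u.
have [p sp] := generator_expand s gent; exists (fun i => p i).
under eq_bigr do rewrite -jpiZ.
rewrite -rmorph_sum -rmorphB; apply/jpi_eq0.
rewrite -[s](subrK (pseval t p)) -addrA; apply: jacobian_setD => //.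
by apply: (power_annihilates gent vk); apply: pseval_psum.
Qed.

(** An isomorphism matches the radicals, which consist of the elements without
    left inverse, hence also their squares. *)
Lemma jac_iso_generator f g : order_ge 2 f -> order_ge 2 g -> jac_iso f g ->
  (exists t, jac_generator g t) -> exists t, jac_generator f t.
Proof.
move=> hf hg /jac_iso_sym[phi [phiZ [psi phiK psiK]]] [t' [ht' gent']].
have phi_surj u : exists v, phi v = u by exists (psi u).
have phiJ : phi @` rad g = rad f.
  apply/seteqP; split=> [_ [u Ju <-]|u Ju].
    apply/(jac_radical_nonunit _ hf) => v vu.
    apply: ((jac_radical_nonunit _ hg).1 Ju (psi v)).
    by apply: (can_inj phiK); rewrite rmorphM psiK vu rmorph1.
  exists (psi u); last exact: psiK.
  apply/(jac_radical_nonunit _ hg) => v vu.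
  apply: ((jac_radical_nonunit _ hf).1 Ju (phi v)).
  by rewrite -[u]psiK -rmorphM vu rmorph1.
have phiJ2 : phi @` ideal_pow (rad g) 2 = ideal_pow (rad f) 2.
  by rewrite image_ideal_pow// phiJ.
have [t tE] := jpi_surj (phi (jpi g t')).
have Jt : rad f (jpi f t).
  rewrite tE -phiJ; exists (jpi g t') => //.
  by rewrite (jac_radicalE hg); exists t' => //; apply/order_ge1P.
exists t; split.
  move: Jt; rewrite (jac_radicalE hf) => -[t0 t00 /jpi_eq/(jacobian_order1 hf)].
  move/order_ge1P; rewrite nccoefD nccoefN t00 sub0r => /eqP.
  by rewrite oppr_eq0 => /eqP/order_ge1P.
move=> s /order_ge1P s0.
have : rad f (jpi f s) by rewrite (jac_radicalE hf); exists s.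
rewrite -phiJ => -[_ /[!(jac_radicalE hg)] -[s' /order_ge1P s'0 <-] sE].
have [c [a Ia ha]] := gent' s' s'0.
exists c; apply/(jac_radical_pow _ _ hf); rewrite -phiJ2.
exists (jpi g s' - c *: jpi g t'); last by rewrite !rmorphB/= jpiZ tE -phiZ -sE.
by rewrite -jpiZ -rmorphB; apply/(jac_radical_pow _ _ hg); exists a.
Qed.

(** The powers [y ^+ i] with [i < N] are independent, because the coefficients
    at these monomials are well defined modulo [V]. *)
Lemma axis_free f y N (V : set (Jac f)) :
  (forall s, V (jpi f s) -> exists2 a,
     axis_ideal y (fun=> True) a & order_ge N (s - a)) ->
  (N%:R%:E <= dim_mod R setT V)%E.
Proof.
pose v (i : 'I_N) := jpi f (ncvar K y ^+ i).
move=> Vax; apply: (dim_mod_ge R (v := v)) => //; rewrite {}/v.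
move=> c; under eq_bigr do rewrite -jpiZ.
rewrite -rmorph_sum => /Vax[a a0 ha] j.
have := ha (nseq j y); rewrite size_nseq => /(_ (ltn_ord j)).
rewrite nccoefD nccoefN a0// subr0 nccoef_sum (bigD1 j)//= big1 => [|i neij].
  by rewrite addr0 nccoefZ coef_ncvarX eqxx mulr1.
rewrite nccoefZ coef_ncvarX; case: eqP => [|]; last by rewrite mulr0.
by move/(congr1 size); rewrite !size_nseq => /val_inj E; rewrite E eqxx in neij.
Qed.

End Dimensions.

(** * The normal forms *)

Section NormalFormJacobi.
Variables (K : fieldType) (d : nat) (hd : (2 <= d)%N).
Hypothesis charK : forall n, n.+1%:R != 0 :> K.
Local Notation S := (ncseries K d).
Local Notation y := (Ordinal (ltn_subr1 hd)).
Local Notation nf := (normal_form K hd).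
Local Notation nf_inf := (normal_form_inf K hd).

Lemma normal_form_infE : nf_inf = \sum_(a | a != y) ncvar K a ^+ 2.
Proof.
pose x := Ordinal (ltn_subr2 hd).
rewrite (bigD1 x)/=; last by rewrite -val_eqE /=; lia.
rewrite addrC; congr (_ + _).
rewrite -(big_ord_narrow (leq_subr 2 d) (F := fun a => ncvar K a ^+ 2)).
by apply: eq_bigl => a; rewrite -!val_eqE/=; have := ltn_ord a; lia.
Qed.

Lemma derivative_normal_form_inf i :
  cyclic_derivative i nf_inf = if i == y then 0 else 2%:R *: ncvar K i.
Proof.
rewrite normal_form_infE (big_morph _ (@cyclic_derivativeD K d i)
  (@cyclic_derivative0 K d i)).
under eq_bigr do rewrite cyclic_derivative_varX expr1.
case: eqP => [->|/eqP neiy]; last first.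
  rewrite (bigD1 i)//= eqxx big1 ?addr0// => a /andP[_ /negPf].
  by rewrite eq_sym => ->.
by rewrite big1// => a /negPf; rewrite eq_sym => ->.
Qed.

Lemma derivative_normal_form i n : cyclic_derivative i (nf n.+1) =
  if i == y then n.+1%:R *: ncvar K y ^+ n else 2%:R *: ncvar K i.
Proof.
rewrite cyclic_derivativeD derivative_normal_form_inf cyclic_derivative_varX.
by case: eqP; rewrite ?add0r ?addr0.
Qed.

Lemma order_ge2_normal_form_inf : order_ge 2 nf_inf.
Proof.
rewrite normal_form_infE; apply: order_ge_sum => a _.
exact/order_geX/order_ge1P.
Qed.

Lemma order_ge2_normal_form n : (2 <= n)%N -> order_ge 2 (nf n).
Proof.
move=> n2; apply: order_geD; first exact: order_ge2_normal_form_inf.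
exact/(order_geW n2)/order_geX/order_ge1P.
Qed.

(** Modulo the ideal, the linear part of a series reduces to its multiple of
    the only remaining variable. *)
Lemma axis_generator g : (forall a, a != y -> jacobian_set g (ncvar K a)) ->
  jac_generator g (ncvar K y).
Proof.
move=> Ia; split=> [|s s0]; first exact/order_ge1P.
exists (s [:: y]), (\sum_(a | a != y) s [:: a] *: ncvar K a).
  apply: (big_ind (jacobian_set g)); first exact: jacobian_set0.
    exact: jacobian_setD.
  by move=> a ay; apply/jacobian_setZ/Ia.
rewrite -addrA -opprD -(bigD1 y (P := xpredT)
  (F := fun a => s [:: a] *: ncvar K a))//.
move=> [|b [|//]] _; rewrite nccoefD nccoefN nccoef_sum.
  by rewrite s0// sub0r big1 ?oppr0// => a _; rewrite nccoefZ mulr0.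
rewrite (bigD1 b)//= big1 ?addr0 => [|a neab].
  by rewrite nccoefZ /ncvar eqxx mulr1 subrr.
by rewrite nccoefZ /ncvar eqseq_cons andbT eq_sym (negPf neab) mulr0.
Qed.

Lemma normal_form_inf_var a : a != y -> jacobian_set nf_inf (ncvar K a).
Proof.
move=> ay; rewrite -(scalerK (charK 1) (ncvar K a)); apply: jacobian_setZ.
have := derivative_jacobian nf_inf a.
by rewrite derivative_normal_form_inf (negPf ay).
Qed.

Lemma normal_form_var n a : a != y -> jacobian_set (nf n.+1) (ncvar K a).
Proof.
move=> ay; rewrite -(scalerK (charK 1) (ncvar K a)); apply: jacobian_setZ.
have := derivative_jacobian (nf n.+1) a.
by rewrite derivative_normal_form (negPf ay).
Qed.

Lemma coef_var_axis a i : a != y -> (ncvar K a : S) (nseq i y) = 0.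
Proof.
by move=> ay; rewrite -[ncvar K a]expr1 coef_ncvarX; case: i => [|[|i]]//=;
  rewrite eqseq_cons ?andbF// andbT eq_sym (negPf ay).
Qed.

Lemma normal_form_inf_generator : jac_generator nf_inf (ncvar K y).
Proof. exact/axis_generator/normal_form_inf_var. Qed.

Lemma normal_form_generator n : jac_generator (nf n.+1) (ncvar K y).
Proof. exact/axis_generator/normal_form_var. Qed.

Lemma normal_form_inf_jacobian :
  jacobian_set nf_inf = axis_ideal y (fun=> True).
Proof.
apply: jacobian_axis => // [|i j _]; first exact: normal_form_inf_generator.
rewrite derivative_normal_form_inf; case: eqP => // /eqP iy.
by rewrite nccoefZ coef_var_axis// mulr0.
Qed.

Lemma normal_form_vanishes n : power_vanishes (nf n.+1) (ncvar K y) n.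
Proof.
exists (ncvar K y ^+ n); last by rewrite subrr.
rewrite -(scalerK (charK n) (ncvar K y ^+ n)); apply: jacobian_setZ.
have := derivative_jacobian (nf n.+1) y.
by rewrite derivative_normal_form eqxx.
Qed.

Lemma normal_form_jacobian n :
  jacobian_set (nf n.+1) = axis_ideal y (fun i => (i < n)%N).
Proof.
apply: jacobian_axis => [|i j leij|i j ltjn|i /negP].
- exact: normal_form_generator.
- exact: leq_ltn_trans.
- rewrite derivative_normal_form; case: eqP => [_|/eqP iy].
    rewrite nccoefZ coef_ncvarX; case: eqP => [/(congr1 size)|].
      by rewrite !size_nseq => E; rewrite E ltnn in ltjn.
    by rewrite mulr0.
  by rewrite nccoefZ coef_var_axis// mulr0.
rewrite -leqNgt => leni; apply: power_vanishesW leni (normal_form_vanishes n).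
exact/order_ge1P.
Qed.

(** If some power of [t] vanishes and [t ^+ k] is the least one, then [k] is the
    length of the Jacobi algebra.  The normal form of exponent [k.+1] has the
    same length, since the derivative of [y ^+ k.+1] is a multiple of [y ^+ k].
    The exponent is at least 2, as [1 = t ^+ 0] is nonzero in the Jacobi
    algebra. *)
Lemma generator_normal_form f t : order_ge 2 f -> jac_generator f t ->
  jac_iso f nf_inf \/ exists2 n, (2 <= n)%N & jac_iso f (nf n).
Proof.
move=> hf gent; have [ht _] := gent.
have [[k vk]|nv] := pselect (exists k, power_vanishes f t k); last first.
  left; apply: (jac_iso_axis gent _ normal_form_inf_jacobian) => i.
  by split=> // _ vi; apply: nv; exists i.
have ex : exists k, `[< power_vanishes f t k >] by exists k; apply/asboolP.
case: (ex_minnP ex) => {vk}k /asboolP vk kmin.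
right; exists k.+1.
  case: k vk {kmin} => // -[a /(jacobian_order1 hf) a0 /order_ge1P].
  rewrite nccoefD nccoefN (order_ge1P a).1// expr0 nccoef1 subr0 => /eqP.
  by rewrite oner_eq0.
apply: (jac_iso_axis gent _ (normal_form_jacobian k)) => i.
split=> [ltik vi|nvi].
  by move/asboolP/kmin: vi; rewrite leqNgt ltik.
by rewrite ltnNge; apply/negP => leki; apply/nvi/(power_vanishesW ht leki vk).
Qed.

End NormalFormJacobi.

(** * Commutativity in two variables *)

Section TwoVariables.
Variables (K : fieldType).
Hypothesis charK : forall n, n.+1%:R != 0 :> K.
Local Notation S := (ncseries K 2).

Definition commutator_free : set S := [set s |
  [/\ s [::] = 0, forall a, s [:: a] = 0 &
      forall a b, s [:: a; b] = s [:: b; a]]].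

(** The coefficient at [ab] is the sum of the coefficients of [f] at the three
    rotations of [iab].  With only two letters, [i] is [a] or [b], and the
    rotations of [iab] and of [iba] are the same words. *)
Lemma derivative_commutator_free (f : S) i : order_ge 2 f ->
  (forall a, cyclic_derivative i f [:: a] = 0) ->
  commutator_free (cyclic_derivative i f).
Proof.
move=> hf der1; split=> [|//|a b].
  by rewrite cyclic_derivativeE big_ord1 hf.
rewrite !cyclic_derivativeE !big_ord_recl !big_ord0 /= !addr0.
have [->//|neab] := eqVneq a b.
have [<-|nei] := eqVneq i a; first by ring.
suff -> : i = b by ring.
apply: val_inj; move: neab nei (ltn_ord i) (ltn_ord a) (ltn_ord b).
by rewrite -!val_eqE /=; lia.
Qed.

Lemma jacobian_commutator_free (f : S) : order_ge 2 f ->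
  (forall i a, cyclic_derivative i f [:: a] = 0) ->
  jacobian_set f `<=` commutator_free.
Proof.
move=> hf der1; apply: jacobian_least => [||i];
  last exact: derivative_commutator_free.
- split; first split; first split=> //.
  + move=> s t [s0 s1 s2] [t0 t1 t2].
    split=> [|a|a b]; rewrite !(nccoefD, nccoefN).
    * by rewrite s0 t0 subrr.
    * by rewrite s1 t1 subrr.
    * by rewrite s2 t2.
  + move=> u s [s0 s1 s2].
    split=> [|a|a b]; rewrite !nccoefM !big_ord_recl !big_ord0 /= ?s0 ?s1
      ?mulr0 ?addr0//.
    by rewrite s2.
  + move=> u s [s0 s1 s2].
    split=> [|a|a b]; rewrite !nccoefM !big_ord_recl !big_ord0 /= ?s0 ?s1
      ?mul0r ?add0r ?addr0//.
    by rewrite s2.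
move=> s Xs; have [x [x0 x1 x2] sx] := Xs 3%N.
have E w : (size w < 3)%N -> s w = x w.
  by move=> hw; rewrite -[s](subrK x) nccoefD sx// add0r.
by split=> [|a|a b]; rewrite !E.
Qed.

(** By [jacobian_commutator_free] some cyclic derivative has a nonzero
    coefficient at a variable; modulo the ideal this variable can be
    eliminated from linear parts, so the other one is a generator. *)
Lemma commutative_generator (f : S) : order_ge 2 f ->
  (forall u v : Jac f, u * v = v * u) -> exists t, jac_generator f t.
Proof.
move=> hf comm.
have [[i [a0 nz]]|der0] :=
    pselect (exists i a, cyclic_derivative i f [:: a] != 0); last first.
  have der1 i a : cyclic_derivative i f [:: a] = 0.
    by apply/eqP/contraT => nz; case: der0; exists i, a.
  pose x : 'I_2 := ord0; pose y : 'I_2 := ord_max.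
  have := comm (jpi f (ncvar K x)) (jpi f (ncvar K y)).
  rewrite -!rmorphM => /jpi_eq/(jacobian_commutator_free hf der1)[_ _].
  move=> /(_ x y); rewrite !(nccoefD, nccoefN) !nccoefM.
  rewrite !big_ord_recl !big_ord0 /=.
  rewrite /ncvar /= !(mul0r, mulr0, mulr1, add0r, addr0, subr0, sub0r).
  by move/eqP; rewrite -subr_eq0 opprK (negPf (charK 1)).
have [b neab ba] : exists2 b : 'I_2, a0 != b & forall c, c = a0 \/ c = b.
  exists (rev_ord a0) => [|c].
    by rewrite -val_eqE /=; have := ltn_ord a0; lia.
  have [/val_inj ->|/val_inj ->] : val c = val a0 \/ val c = val (rev_ord a0).
  - by rewrite /=; have := ltn_ord a0; have := ltn_ord c; lia.
  - by left.
  - by right.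
exists (ncvar K b); split; first exact/order_ge1P.
set e := cyclic_derivative i f in nz *.
have Ie : jacobian_set f e by apply: derivative_jacobian.
have e0 := jacobian_order1 hf Ie.
move=> s s0; pose l := s [:: a0] / e [:: a0].
(* [l] is chosen to cancel the coefficient at the eliminated variable. *)
exists (s [:: b] - l * e [:: b]), (l *: e); first exact: jacobian_setZ.
move=> [|c [|//]] _; rewrite !(nccoefD, nccoefN, nccoefZ).
  by rewrite s0// (e0 [::])// /ncvar/= !mulr0 !subr0.
rewrite /ncvar eqseq_cons andbT; have [->|->] := ba c.
  by rewrite (negPf neab) mulr0 subr0 /l divfK// subrr.
by rewrite eqxx mulr1; ring.
Qed.

End TwoVariables.

(** * The classification *)

(** For [r < 1], any integer above [c `^ (1 - r)^-1] violates the bound. *)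
Lemma linear_growth_exponent (R : realType) (c r : R) :
  (forall n : nat, n%:R <= c * n%:R `^ r) -> 1 <= r.
Proof.
move=> growth; rewrite leNgt; apply/negP => r1.
have c1 : 1 <= c by have := growth 1%N; rewrite powR1 mulr1.
have e0 : 0 < 1 - r by rewrite subr_gt0.
pose n := (Num.truncn (c `^ (1 - r)^-1)).+1.
have ltn : c `^ (1 - r)^-1 < n%:R by apply: truncnS_gt.
have n0 : (0 : R) < n%:R by rewrite ltr0n.
have cn : c < n%:R `^ (1 - r).
  have c0 : 0 <= c by apply: le_trans c1.
  have := gt0_ltr_powR e0 _ _ ltn.
  rewrite -powRrM mulVf ?gt_eqF// powRr1//.
  by apply; rewrite nnegrE ?powR_ge0// ler0n.
have := growth n; rewrite leNgt => /negP; apply.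
have {2}-> : n%:R = n%:R `^ (1 - r) * n%:R `^ r :> R.
  by rewrite -powRD ?subrK ?powRr1// gt_eqF ?implybT.
by rewrite ltr_pM2r// powR_gt0.
Qed.

Theorem proposition1p2 (R : realType) (d : nat) (hd : (2 <= d)%N)
    (f : ncseries R[i] d) (hf : order_ge 2 f) :
  (((corank f <= 1)%E <->
      (jac_iso f (normal_form_inf R[i] hd) \/
       exists2 n : nat, (2 <= n)%N & jac_iso f (normal_form R[i] hd n)))
   /\ (forall n : nat, (2 <= n)%N ->
         (jac_dim (normal_form R[i] hd n) < +oo)%E)
   /\ (jac_dim (normal_form_inf R[i] hd) = +oo)%E
   /\ (jdim (normal_form_inf R[i] hd) = 1)%E)
  /\ (d = 2%N ->
        ((forall a b : Jac f, a * b = b * a) <-> (corank f <= 1)%E)).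
Proof.
have charC n : n.+1%:R != 0 :> R[i] by rewrite pnatr_eq0.
set nf_inf := normal_form_inf _ _.
have hinf : order_ge 2 nf_inf := order_ge2_normal_form_inf R[i] hd.
have ginf := normal_form_inf_generator hd charC.
have Iinf := normal_form_inf_jacobian hd charC.
have corankE : (corank f <= 1)%E <-> exists t, jac_generator f t.
  exact: dim_cotangent_le1.
split; last first.
  move=> d2; split=> [comm|/corankE[t]]; last first.
    exact: generator_commutative.
  apply/corankE; clear corankE Iinf ginf hinf nf_inf.
  clear hd; subst d; exact: commutative_generator.
split; first split.
- by move=> /corankE[t gent]; apply: generator_normal_form hf gent.
- move=> fnf; apply/corankE; case: fnf => [fnf|[n n2 fnf]].
    by apply: (jac_iso_generator hf hinf fnf); eexists; exact: ginf.
  apply: (jac_iso_generator hf (order_ge2_normal_form R[i] hd n2) fnf).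
  by case: n n2 {fnf} => // n _; eexists; exact: normal_form_generator.
split; first last; first split.
- apply/eqyP => A _; apply: (@le_trans _ _ (Num.truncn A).+1%:R%:E).
    by rewrite lee_fin ltW// truncnS_gt.
  apply: axis_free => s /jpi_eq0 Is.
  by exists s; [rewrite Iinf in Is; exact: Is|rewrite subrr].
- apply/le_anti/andP; split.
    apply: ereal_inf_lbound; exists 1 => //; split=> //.
    exists 1 => n; rewrite mul1r powRr1//; exact: generator_dim ginf.
  apply: le_ereal_inf_tmp => _ [r [r0 [c growth]] <-].
  rewrite lee_fin; apply: (@linear_growth_exponent R c) => n.
  rewrite -lee_fin; apply: le_trans (growth n).
  apply: axis_free => s /(jac_radical_pow _ _ hinf)[a Ia ha].
  by exists a => //; rewrite Iinf in Ia; exact: Ia.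
case=> // n _; apply: (@le_lt_trans _ _ n%:R%:E); last exact: ltry.
apply: generator_jac_dim (normal_form_vanishes hd charC n).
exact: normal_form_generator.
Qed.
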